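(* The (1 or 2)-Visits problem reduces to the Position Matching problem in time $O(n+m)$.
   Context: (1 or 2)-Visits: given positive integers $m,n$ and a multiset of positive integers $D=\{d_1,\ldots,d_{m+n}\}$ with $d_1\leq\cdots\leq d_m$ and $d_{m+1}\leq\cdots\leq d_{m+n}$, decide whether there is a sequence of length $m+2n$ (one task per position) such that each task $i\in[m]$ is visited exactly once, within the first $d_i$ positions, and each task $i\in\{m+1,\ldots,m+n\}$ is visited exactly twice, the first time within the first $d_i$ positions and the second time at most $d_i$ positions after the first. Discretized sequence: for a non-decreasing sequence $\langle d_1,\ldots,d_n\rangle$, $a_n=d_n$ and $a_i=\min\{a_{i+1}-1,\ d_i\}$ for $i<n$. Position Matching: given a multiset $D'=\{d'_1,\ldots,d'_n\}$ and a simple set $T=\{t_1,\ldots,t_n\}$ of positive integers, with $A$ the discretized sequence of $D'$, decide whether there is $M\subseteq D'\times A\times T$ in which every element of $D'$, $A$, $T$ occurs exactly once and each $(d,a,t)\in M$ satisfies $d\geq a$ and $d+a\geq t$. A reduction maps instances to equivalent instances (yes iff yes). *)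

(* Defs.v *)
From mathcomp Require Import all_boot all_order all_algebra.

Set Implicit Arguments.
Unset Strict Implicit.
Unset Printing Implicit Defensive.

Import Order.TTheory GRing.Theory Num.Theory.

(* The unit-cost random access machine of Cook and Reckhow, in its variant with
   registers X_0, X_1, ... holding natural numbers.  The input tape is read from
   left to right, and the output tape is written from left to right. *)
Inductive instr : Type :=
| Const of nat & nat        (* Const i c   : X_i <- c *)
| Plus of nat & nat & nat   (* Plus i j k  : X_i <- X_j + X_k *)
| Minus of nat & nat & nat  (* Minus i j k : X_i <- X_j - X_k, truncated at 0 *)
| Get of nat & nat          (* Get i j     : X_i <- X_(X_j) *)
| Put of nat & nat          (* Put i j     : X_(X_i) <- X_j *)
| JumpPos of nat & nat      (* JumpPos l j : go to instruction l if X_j > 0 *)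
| Read of nat               (* Read i      : X_i <- next input, 0 at the end *)
| Print of nat.             (* Print i     : append X_i to the output *)

Definition program := seq instr.

Record config : Type := Config {
  pc : nat;
  reg : nat -> nat;
  input : seq nat;
  output : seq nat
}.

Definition update (r : nat -> nat) (i v : nat) : nat -> nat :=
  fun j => if j == i then v else r j.

Definition exec (ins : instr) (s : config) : config :=
  let: Config p r x y := s in
  match ins with
  | Const i c => Config p.+1 (update r i c) x y
  | Plus i j k => Config p.+1 (update r i (r j + r k)) x y
  | Minus i j k => Config p.+1 (update r i (r j - r k)) x y
  | Get i j => Config p.+1 (update r i (r (r j))) x y
  | Put i j => Config p.+1 (update r (r i) (r j)) x y
  | JumpPos l j => Config (if 0 < r j then l else p.+1) r x y
  | Read i => Config p.+1 (update r i (head 0 x)) (behead x) y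
  | Print i => Config p.+1 r x (rcons y (r i))
  end.

(* The machine halts when the program counter leaves the program; a halted
   configuration is a fixed point of [step]. *)
Definition halted (P : program) (s : config) : bool := size P <= pc s.

Definition step (P : program) (s : config) : config :=
  if onth P (pc s) is Some ins then exec ins s else s.

Definition start (x : seq nat) : config := Config 0 (fun=> 0) x [::].

Definition computes_within (P : program) (x : seq nat) (t : nat) (y : seq nat)
    : Prop :=
  let s := iter t (step P) (start x) in halted P s /\ output s = y.

Record problem : Type := Problem {
  instance : Type;
  encode : instance -> seq nat;
  yes : instance -> Prop
}.

(* Reducibility in time O(f): one program, independent of the instance, maps the
   encoding of each instance of A to that of an equivalent instance of B. *)
Definition reduces_in_time (A B : problem) (f : instance A -> nat) : Prop :=
  exists (P : program) (c : nat), forall x : instance A,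
    exists y : instance B,
      computes_within P (encode x) (c * f x) (encode y) /\ (yes x <-> yes y).

(* Tasks and positions are numbered from 0, so the tasks to be visited once are
   those of index i < m, and p : 'I_(m + 2 * n) is the position p.+1. *)
Record visits_instance : Type := VisitsInstance {
  vm : nat;
  vn : nat;
  vd : (vm + vn).-tuple nat;
  vm_gt0 : 0 < vm;
  vn_gt0 : 0 < vn;
  vd_gt0 : all (leq 1) vd;
  vd_sorted1 : sorted leq (take vm vd);
  vd_sorted2 : sorted leq (drop vm vd)
}.

Definition visits_encode (I : visits_instance) : seq nat :=
  vm I :: vn I :: vd I.

Definition visited_once (m n d : nat)
    (s : {ffun 'I_(m + 2 * n) -> 'I_(m + n)}) (i : 'I_(m + n)) : Prop :=
  exists p : 'I_(m + 2 * n), [set x | s x == i] = [set p] /\ p.+1 <= d.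

Definition visited_twice (m n d : nat)
    (s : {ffun 'I_(m + 2 * n) -> 'I_(m + n)}) (i : 'I_(m + n)) : Prop :=
  exists p q : 'I_(m + 2 * n),
    [/\ p < q, [set x | s x == i] = [set p; q], p.+1 <= d & q - p <= d].

Definition visits_yes (I : visits_instance) : Prop :=
  exists s : {ffun 'I_(vm I + 2 * vn I) -> 'I_(vm I + vn I)},
    forall i : 'I_(vm I + vn I),
      if i < vm I then visited_once (tnth (vd I) i) s i
      else visited_twice (tnth (vd I) i) s i.

Definition one_or_two_visits : problem :=
  Problem visits_encode visits_yes.

(* The values are integers since they may become negative. *)
Fixpoint discretized (d : seq nat) : seq int :=
  match d with
  | [::] => [::]
  | x :: d' =>
      let a := discretized d' in
      (if a is b :: _ then Num.min (b - 1) x%:Z else x%:Z)%R :: a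
  end.

(* The multiset D' is given by an enumeration in arbitrary order. *)
Record matching_instance : Type := MatchingInstance {
  pn : nat;
  pD : pn.-tuple nat;
  pT : pn.-tuple nat;
  pn_gt0 : 0 < pn;
  pD_gt0 : all (leq 1) pD;
  pT_gt0 : all (leq 1) pT;
  pT_uniq : uniq pT
}.

Definition matching_encode (I : matching_instance) : seq nat :=
  pn I :: pD I ++ pT I.

Definition matching_yes (I : matching_instance) : Prop :=
  exists M : seq (nat * int * nat),
    [/\ perm_eq [seq x.1.1 | x <- M] (pD I),
        perm_eq [seq x.1.2 | x <- M] (discretized (sort leq (pD I))),
        perm_eq [seq x.2 | x <- M] (pT I) &
        forall (d : nat) (a : int) (t : nat), (d, a, t) \in M ->
          (a <= d%:Z)%R /\ (t%:Z <= d%:Z + a)%R].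

Definition position_matching : problem :=
  Problem matching_encode matching_yes.

(* Main.v *)
(* Let N = m + 2n; deadlines may be capped at N.  In a schedule, positions can be
   traded from the last one down: as long as a task to be visited twice with deadline
   at least x still lacks a first visit, some such visit may be moved to position x,
   whose former holder moves to an earlier position; failing that, the same holds for
   the tasks to be visited once; otherwise x holds a second visit.  So the first
   visits can be assumed to occupy the discretized sequence of the deadlines of the
   twice-visited tasks, the single visits the positions chosen greedily among the
   others, and the remaining positions form T.  The greedy choice only depends on
   how many tasks have each deadline, so one downward pass over bucket counts computes
   it in linear time.  If it leaves a task unplaced there is no schedule, and shifting
   T above 2N gives an instance of Position Matching without solution. *)
Require Import Defs.
From mathcomp Require Import all_boot all_order all_algebra.
From mathcomp Require Import zify.

Set Implicit Arguments.
Unset Strict Implicit.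
Unset Printing Implicit Defensive.

Import Order.TTheory GRing.Theory Num.Theory.

(** * The greedy pass *)

(* [scan cS cD x pS pD A R T e]: the pass over positions x, ..., 1, where [cS y] tasks
   visited once and [cD y] tasks visited twice have deadline y, and [pS] and [pD] tasks
   of deadline above x are still to be placed.  First visits get [A], single visits [R],
   the free positions are [T], and [e] tasks remain unplaced. *)
Inductive scan (cS cD : nat -> nat) :
    nat -> nat -> nat -> seq nat -> seq nat -> seq nat -> nat -> Prop :=
| Scan0 pS pD : scan cS cD 0 pS pD [::] [::] [::] (pS + pD)
| ScanTwice x pS pD A R T p :
    0 < pD + cD x.+1 ->
    scan cS cD x (pS + cS x.+1) (pD + cD x.+1).-1 A R T p ->
    scan cS cD x.+1 pS pD (x.+1 :: A) R T p
| ScanOnce x pS pD A R T p :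
    pD + cD x.+1 = 0 -> 0 < pS + cS x.+1 ->
    scan cS cD x (pS + cS x.+1).-1 0 A R T p ->
    scan cS cD x.+1 pS pD A (x.+1 :: R) T p
| ScanFree x pS pD A R T p :
    pD + cD x.+1 = 0 -> pS + cS x.+1 = 0 ->
    scan cS cD x 0 0 A R T p ->
    scan cS cD x.+1 pS pD A R (x.+1 :: T) p.

Lemma perm_iotaS x : perm_eq (iota 1 x.+1) (x.+1 :: iota 1 x).
Proof. by rewrite -(addn1 x) iotaD -cat1s perm_catC addn1 add1n. Qed.

Lemma scan_perm cS cD x pS pD A R T p :
  scan cS cD x pS pD A R T p -> perm_eq (A ++ R ++ T) (iota 1 x).
Proof.
have perm_mid (s t : seq nat) y : perm_eq (s ++ y :: t) (y :: s ++ t).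
  by rewrite -cat1s perm_catCA.
elim=> // {x pS pD A R T p} x pS pD A R T p; [move=> _ _|move=> _ _ _|move=> _ _ _];
  move=> IH; rewrite (permPr (perm_iotaS x)).
- by rewrite perm_cons.
- by rewrite (permPl (perm_mid A (R ++ T) x.+1)) perm_cons.
- by rewrite catA (permPl (perm_mid (A ++ R) T x.+1)) perm_cons -catA.
Qed.

(* The invariant of [scan] for the unplaced tasks [js]. *)
Definition pending (I : Type) (d : I -> nat) (js : seq I) (x p : nat)
    (c : nat -> nat) : Prop :=
  count (fun j => x < d j) js = p /\
  forall y, 0 < y <= x -> count (fun j => d j == y) js = c y.

(** The tasks with deadline above [x] are those above [x.+1] together with the bucket of [x.+1],
    which the pass adds to its counter. *)
Lemma pendingS (I : Type) (d : I -> nat) js x p c :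
  pending d js x.+1 p c -> pending d js x (p + c x.+1) c.
Proof.
case=> <- H; split=> [|y /andP[y0 yx]]; last by rewrite H // y0 leqW.
rewrite -H ?ltnSn // -count_predUI [X in _ + X](eq_count (a2 := pred0)).
  by rewrite count_pred0 addn0; apply: eq_count => j /=; rewrite leq_eqVlt orbC eq_sym.
by move=> j /=; lia.
Qed.

Lemma pending_rem (I : eqType) (d : I -> nat) js x p c j :
  pending d js x p c -> j \in js -> x < d j -> pending d (rem j js) x p.-1 c.
Proof.
case=> <- H js_j xj; split=> [|y yx].
  by rewrite count_rem js_j xj subn1.
by rewrite count_rem js_j H //; lia.
Qed.

Lemma pending_pick (I : eqType) (d : I -> nat) js x p c :
  pending d js x p c -> 0 < p -> exists2 j, j \in js & x < d j.
Proof. by case=> <- _; rewrite -has_count => /hasP. Qed.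

Lemma pending_le (I : eqType) (d : I -> nat) js x c j :
  pending d js x 0 c -> j \in js -> d j <= x.
Proof.
case=> /eqP; rewrite eqn0Ngt -has_count => /hasPn H _ /H.
by rewrite -leqNgt.
Qed.

(** Each position given to a visit removes one pending task; as all deadlines are positive, every
    task left at position 0 is counted in [p]. *)
Lemma scan_size (I J : eqType) (dD : I -> nat) (dS : J -> nat)
    cS cD x pS pD A R T p :
  scan cS cD x pS pD A R T p ->
  forall js ks, pending dD js x pD cD -> pending dS ks x pS cS ->
  {in js, forall j, 0 < dD j} -> {in ks, forall k, 0 < dS k} ->
  size A + size R + p = size js + size ks.
Proof.
have rem_in (K : eqType) (P : K -> Prop) s z :
  {in s, forall y, P y} -> {in rem z s, forall y, P y} by move=> H y /mem_rem/H.
elim=> {x pS pD A R T p}.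
- move=> pS pD js ks [<- _] [<- _] /allP dj /allP dk.
  by move: dj dk; rewrite !all_count => /eqP-> /eqP->; rewrite !add0n addnC.
- move=> x pS pD A R T p p0 _ IH js ks /pendingS pj /pendingS pk dj dk.
  have [j jj xj] := pending_pick pj p0.
  have := IH _ _ (pending_rem pj jj xj) pk (rem_in _ _ _ _ dj) dk.
  by rewrite size_rem //= => E; case: (js) jj E => //= ? ? _; rewrite ?addSn => ->.
- move=> x pS pD A R T p z p0 _ IH js ks /pendingS pj /pendingS pk dj dk.
  rewrite z in pj; have [k kk xk] := pending_pick pk p0.
  have := IH _ _ pj (pending_rem pk kk xk) dj (rem_in _ _ _ _ dk).
  by rewrite size_rem //= => E; case: (ks) kk E => //= ? ? _; rewrite addnS addSn => ->;
    rewrite addnS.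
- move=> x pS pD A R T p z z' _ IH js ks /pendingS pj /pendingS pk dj dk.
  by rewrite z in pj; rewrite z' in pk; apply: IH.
Qed.

(** * Moving visits between positions *)

Lemma perm_replace (K : eqType) (x a : K) s :
  uniq (a :: s) -> x \in a :: s ->
  perm_eq (x :: [seq if v == x then a else v | v <- s]) (a :: s).
Proof.
have id_map t : x \notin t -> [seq if v == x then a else v | v <- t] = t.
  move=> xt; rewrite -[RHS]map_id; apply/eq_in_map => v.
  by case: eqVneq => // ->; rewrite (negPf xt).
rewrite /= inE => /andP[a_s us] /orP[/eqP xa|]; first by rewrite id_map xa.
move=> xs; case/splitPr: xs us {a_s} => s1 s2; rewrite cat_uniq /= negb_or -!andbA.
move=> /and5P[_ x1 _ x2 _]; rewrite map_cat /= eqxx !id_map //.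
by apply/permP => P; rewrite /= !count_cat /=; lia.
Qed.

Lemma map_override (I : eqType) (K : Type) (f : I -> K) j v s :
  j \notin s -> [seq if z == j then v else f z | z <- s] = map f s.
Proof.
by move=> js; apply/eq_in_map => z; case: eqVneq => // ->; rewrite (negPf js).
Qed.

Lemma perm_map_override (I K : eqType) (f : I -> K) j v s :
  uniq s -> j \in s ->
  perm_eq [seq if z == j then v else f z | z <- s] (v :: map f (rem j s)).
Proof.
move=> us js; rewrite (permPl (perm_map _ (perm_to_rem js))) /= eqxx perm_cons.
by rewrite map_override // mem_rem_uniq // !inE eqxx.
Qed.

(** Sufficiency of the greedy choice: a single visit is put at [x.+1] only if some pending task has
    deadline above [x], and any such task will do. With [p = 0] none is left at the end. *)
Lemma scan_assign (I : eqType) (d : I -> nat) cS cD x pS pD A R T p :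
  scan cS cD x pS pD A R T p -> p = 0 ->
  forall ks, pending d ks x pS cS -> uniq ks -> {in ks, forall k, 0 < d k} ->
  exists2 pos : I -> nat,
    perm_eq (map pos ks) R & {in ks, forall k, pos k <= d k}.
Proof.
elim=> {x pS pD A R T p}.
- move=> pS pD Ep ks [Ek _] _ dk; exists (fun=> 0) => //.
  suff ->: ks = [::] by [].
  move/allP: dk; rewrite all_count Ek; case: (ks) => //= k s; lia.
- by move=> x pS pD A R T p p0 _ IH /IH {}IH ks /pendingS pk; apply: IH.
- move=> x pS pD A R T p z p0 _ IH /IH {}IH ks /pendingS pk uk dk.
  have [k kk xk] := pending_pick pk p0.
  have [||pos Pp Hp] := IH _ (pending_rem pk kk xk); first exact: rem_uniq.
    by move=> y /mem_rem /dk.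
  exists (fun y => if y == k then x.+1 else pos y).
    by rewrite (permPl (perm_map_override _ _ uk kk)) perm_cons.
  move=> y; rewrite (perm_mem (perm_to_rem kk)) inE; case: eqVneq => [-> //|_ /=].
  exact: Hp.
- move=> x pS pD A R T p z z' _ IH /IH {}IH ks /pendingS pk.
  by rewrite z' in pk; apply: IH.
Qed.

(* The holder of the last position [x.+1] and the visit [j] trade places. *)
Lemma trade_last (I : eqType) (pos : I -> nat) (L L' : seq I) j x :
  perm_eq (map pos L) (iota 1 x.+1) -> perm_eq L (j :: L') ->
  exists pos0 : I -> nat,
    [/\ perm_eq (map pos0 L') (iota 1 x),
        {in L', forall z, pos0 z <= pos z},
        {in L', forall z, pos z != x.+1 -> pos0 z = pos z} &
        pos j = x.+1 -> {in L', pos0 =1 pos}].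
Proof.
move=> pL LL'; have {pL LL'} : perm_eq (pos j :: map pos L') (iota 1 x.+1).
  by rewrite -map_cons -(permPl (perm_map pos LL')).
move=> pL; have uL : uniq (pos j :: map pos L') by rewrite (perm_uniq pL) iota_uniq.
have xL : x.+1 \in pos j :: map pos L' by rewrite (perm_mem pL) mem_iota; lia.
exists (fun z => if pos z == x.+1 then pos j else pos z); split.
- rewrite -(perm_cons x.+1) -(permPr (perm_iotaS x)) -(permPr pL).
  by rewrite -(permPr (perm_replace uL xL)) -map_comp.
- move=> z _; case: eqVneq => // ->.
  have: pos j \in iota 1 x.+1 by rewrite -(perm_mem pL) mem_head.
  by rewrite mem_iota; lia.
- by move=> z _ /negPf->.
- by move=> -> z _; case: eqVneq.
Qed.

(* [js], [ks] and [ls] are the first visits, the single visits and the second visits. *)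
Lemma scan_exchange (I : eqType) (d : I -> nat) cS cD x pS pD A R T p :
  scan cS cD x pS pD A R T p ->
  forall (js ks ls : seq I) (pos : I -> nat),
  uniq (js ++ ks ++ ls) -> perm_eq (map pos (js ++ ks ++ ls)) (iota 1 x) ->
  pending d js x pD cD -> pending d ks x pS cS ->
  {in js ++ ks, forall j, pos j <= d j} ->
  p = 0 /\ exists pos' : I -> nat,
    [/\ perm_eq (map pos' js) A, perm_eq (map pos' ls) T,
        {in js, forall j, pos j <= pos' j <= d j} &
        {in ls, forall l, pos' l <= pos l}].
Proof.
elim=> {x pS pD A R T p}.
- move=> pS pD js ks ls pos _ /perm_size /=; rewrite size_map !size_cat.
  case: js ks ls => [|//] [|//] [|//] _ [<- _] [<- _] _.
  by split=> //; exists pos.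
- move=> x pS pD A R T p p0 _ IH js ks ls pos uL pL /pendingS pj /pendingS pk dl.
  (* If a first visit already holds the last position, it has to be the one chosen: otherwise the
     trade would move it to an earlier position, against the bound [pos j <= pos' j]. *)
  have [j [jj xj sel]] : exists j, [/\ j \in js, x < d j &
      forall z, z \in js -> pos z = x.+1 -> pos j = x.+1].
    have [/hasP[j jj /eqP xj]|/hasPn noj] := boolP (has (fun z => pos z == x.+1) js).
      by exists j; split=> //; rewrite -xj; apply: dl; rewrite mem_cat jj.
    have [j jj xj] := pending_pick pj p0.
    by exists j; split=> // z /noj /eqP.
  have LL' : perm_eq (js ++ ks ++ ls) (j :: rem j js ++ ks ++ ls).
    by rewrite -cat_cons perm_cat2r perm_to_rem.
  have [pos0 [p0L p0le p0eq p0eq']] := trade_last pL LL'.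
  have uL' := uL; rewrite (perm_uniq LL') in uL'; case/andP: uL' => jL' uL'.
  have [|p_0 [pos1 [A1 T1 j1 l1]]] := IH _ _ _ pos0 uL' p0L (pending_rem pj jj xj) pk.
    move=> z zjk; apply: leq_trans (dl z _).
      by apply: p0le; rewrite catA mem_cat zjk.
    by move: zjk; rewrite !mem_cat => /orP[/mem_rem|] ->; rewrite ?orbT.
  split=> //; exists (fun z => if z == j then x.+1 else pos1 z).
  have uj : uniq js by move: uL; rewrite cat_uniq => /andP[].
  split.
  + by rewrite (permPl (perm_map_override _ _ uj jj)) perm_cons.
  + by rewrite map_override //; apply: contra jL'; rewrite !mem_cat => ->; rewrite !orbT.
  + move=> z zj; case: eqVneq => [->|z_j].
      rewrite xj andbT; have: pos j \in iota 1 x.+1.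
        by rewrite -(perm_mem pL) map_f // mem_cat jj.
      by rewrite mem_iota; lia.
    have zr : z \in rem j js by rewrite mem_rem_uniq // inE z_j.
    have zL : z \in rem j js ++ ks ++ ls by rewrite mem_cat zr.
    rewrite (_ : pos z = pos0 z); first exact: j1.
    have [zx|zx] := eqVneq (pos z) x.+1; last by rewrite p0eq.
    by rewrite (p0eq' (sel _ zj zx)).
  + move=> z zl; have zL : z \in rem j js ++ ks ++ ls by rewrite !mem_cat zl !orbT.
    rewrite ifN; first by apply: leq_trans (l1 _ zl) (p0le _ zL).
    exact: (memPn jL').
- move=> x pS pD A R T p z p0 _ IH js ks ls pos uL pL /pendingS pj /pendingS pk dl.
  rewrite z in pj; have [k kk xk] := pending_pick pk p0.
  have LL' : perm_eq (js ++ ks ++ ls) (k :: js ++ rem k ks ++ ls).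
    have /permP kP := perm_to_rem kk.
    by apply/permP => P; rewrite /= !count_cat kP /=; lia.
  have [pos0 [p0L p0le p0eq _]] := trade_last pL LL'.
  have uL' := uL; rewrite (perm_uniq LL') in uL'; case/andP: uL' => kL' uL'.
  have [|p_0 [pos1 [A1 T1 j1 l1]]] := IH _ _ _ pos0 uL' p0L pj (pending_rem pk kk xk).
    move=> y yjk; apply: leq_trans (dl y _).
      by apply: p0le; rewrite catA mem_cat yjk.
    by move: yjk; rewrite !mem_cat => /orP[|/mem_rem] ->; rewrite ?orbT.
  split=> //; exists pos1; split=> //.
  (* The deadlines left in [js] are at most [x], so no first visit sits at [x.+1] and the trade
     leaves them all in place. *)
  + move=> y yj; rewrite -(p0eq y) ?j1 ?mem_cat ?yj //.
    have := dl y; rewrite mem_cat yj => /(_ isT); have := pending_le pj yj; lia.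
  + move=> y yl; apply: leq_trans (l1 _ yl) (p0le _ _).
    by rewrite !mem_cat yl !orbT.
- move=> x pS pD A R T p z z' _ IH js ks ls pos uL pL /pendingS pj /pendingS pk dl.
  rewrite z in pj; rewrite z' in pk.
  (* All first and single visits are due by [x], so the last position is held by a second visit,
     which stays there. *)
  have: x.+1 \in iota 1 x.+1 by rewrite mem_iota; lia.
  rewrite -(perm_mem pL) => /mapP[i iL ix].
  have il : i \in ls.
    move: iL; rewrite catA mem_cat => /orP[ijk|//].
    have := dl _ ijk; move: ijk; rewrite mem_cat => /orP[/(pending_le pj)|/(pending_le pk)]; lia.
  have LL' : perm_eq (js ++ ks ++ ls) (i :: js ++ ks ++ rem i ls).
    have /permP iP := perm_to_rem il.
    by apply/permP => P; rewrite /= !count_cat iP /=; lia.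
  have [pos0 [p0L _ _ /(_ (esym ix)) p0eq]] := trade_last pL LL'.
  have uL' := uL; rewrite (perm_uniq LL') in uL'; case/andP: uL' => iL' uL'.
  have [|p_0 [pos1 [A1 T1 j1 l1]]] := IH _ _ _ pos0 uL' p0L pj pk.
    by move=> y yjk; rewrite p0eq ?dl // catA mem_cat yjk.
  have ul : uniq ls by move: uL; rewrite !cat_uniq => /and3P[_ _ /and3P[]].
  split=> //; exists (fun y => if y == i then x.+1 else pos1 y); split.
  + by rewrite map_override //; apply: contra iL'; rewrite !mem_cat => ->.
  + by rewrite (permPl (perm_map_override _ _ ul il)) perm_cons.
  + move=> y yj; rewrite ifN; last by apply: (memPn iL'); rewrite mem_cat yj.
    by rewrite -p0eq ?j1 // mem_cat yj.
  + move=> y yl; case: eqVneq => [->|yi]; first by rewrite ix.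
    have yr : y \in rem i ls by rewrite mem_rem_uniq // inE yi.
    by rewrite -(p0eq y) ?l1 // !mem_cat yr !orbT.
Qed.

(* The discretized sequence, from the largest deadline down, with values at most [c]. *)
Fixpoint latest (c : int) (s : seq nat) : seq int :=
  if s is x :: s' then
    let a := Num.min c (Posz x) in a :: latest (a - 1)%R s'
  else [::].

(** The default [c + 1] of [last] turns into the cap [c] itself when [s] is empty. *)
Lemma latest_rcons c s x :
  latest c (rcons s x) =
    rcons (latest c s) (Num.min (last (c + 1) (latest c s) - 1) (Posz x))%R.
Proof.
elim: s c => [|y s IH] c /=; first by rewrite addrK.
by rewrite IH /= subrK.
Qed.

(** The recursion of [discretized] starts from the end of the list, that is from the head of the
    reversed list; there a cap no smaller than any deadline has no effect. *)
Lemma discretizedE (c : int) s :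
  all (fun x => Posz x <= c)%R s -> discretized s = rev (latest c (rev s)).
Proof.
elim: s => // x s IH /= /andP[xc /IH->].
rewrite rev_cons latest_rcons rev_rcons; congr (_ :: _).
case/lastP: (latest c (rev s)) => [|t y]; first by rewrite /= addrK; apply/esym/min_idPr.
by rewrite rev_rcons last_rcons.
Qed.

(** While a task is pending, the largest deadline exceeds [x] and the minimum is the cap [x.+1], the
    position that the pass puts in [A]. Otherwise all deadlines are at most [x], and lowering the
    cap to [x] changes nothing. *)
Lemma scan_latest cS cD x pS pD A R T p :
  scan cS cD x pS pD A R T p -> p = 0 ->
  forall s : seq nat, pending id s x pD cD -> sorted geq s -> all (leq 1) s ->
  latest (Posz x) s = map Posz A.
Proof.
elim=> {x pS pD A R T p}.
- move=> pS pD Ep s [Es _] _ ds; suff ->: s = [::] by [].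
  by move: ds; rewrite all_count Es; case: (s) => //= k s'; lia.
- move=> x pS pD A R T p p0 _ IH /IH{}IH [|y s] /pendingS ps; first by case: ps p0 => <-.
  move=> /= sorted_s /andP[y0 ds].
  have xy : x < y.
    have [z] := pending_pick ps p0; rewrite inE => /predU1P[->//|zs] /leq_trans; apply.
    move: sorted_s; rewrite path_sortedE; [by case/andP=> /allP/(_ z zs)|].
    by move=> ? ? ? /[swap]; apply: leq_trans.
  rewrite (min_idPl _); last by lia.
  congr (_ :: _); rewrite (_ : (_ - 1)%R = Posz x); last by lia.
  apply: IH => //; last exact: path_sorted sorted_s.
  by have := pending_rem ps (mem_head y s) xy; rewrite /= eqxx.
- move=> x pS pD A R T p z p0 _ IH /IH{}IH s /pendingS ps sorted_s ds.
  rewrite z in ps; rewrite -(IH _ ps) //; case: s {sorted_s ds} ps => //= y s ps.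
  have := pending_le ps (mem_head y s) => /= yx.
  by rewrite !(min_idPr _) //; lia.
- move=> x pS pD A R T p z z' _ IH /IH{}IH s /pendingS ps sorted_s ds.
  rewrite z in ps; rewrite -(IH _ ps) //; case: s {sorted_s ds} ps => //= y s ps.
  have := pending_le ps (mem_head y s) => /= yx.
  by rewrite !(min_idPr _) //; lia.
Qed.

(** * Schedules *)

(* The two visits of a task are unordered: exchanging them when [q j < p j] keeps both
   conditions. *)
Definition schedule (m n : nat) (dS : 'I_m -> nat) (dD : 'I_n -> nat)
    (r : 'I_m -> nat) (p q : 'I_n -> nat) : Prop :=
  [/\ perm_eq (codom p ++ codom r ++ codom q) (iota 1 (m + 2 * n)),
      forall i, r i <= dS i, forall j, p j <= dD j &
      forall j, q j <= p j + dD j].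

(** There are as many visits as positions. Hence visits that cover all positions do not collide, and
    an injective choice of a visit for each position is a bijection. *)
Lemma visits_yesP (I : visits_instance) :
  visits_yes I <-> exists r p q,
    schedule (fun i : 'I_(vm I) => tnth (vd I) (lshift (vn I) i))
      (fun j : 'I_(vn I) => tnth (vd I) (rshift (vm I) j)) r p q.
Proof.
case: I => m n d ? ? ? ? ?; rewrite /visits_yes /=; split.
- case=> s Hs.
  have /fin_all_exists[r Hr] : forall i : 'I_m, exists r : 'I_(m + 2 * n),
      [set x | s x == lshift n i] = [set r] /\ r.+1 <= tnth d (lshift n i).
    by move=> i; have := Hs (lshift n i); rewrite /= ltn_ord.
  have /fin_all_exists[pq Hpq] : forall j : 'I_n,
      exists pq : 'I_(m + 2 * n) * 'I_(m + 2 * n),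
      [/\ pq.1 < pq.2, [set x | s x == rshift m j] = [set pq.1; pq.2],
      pq.1.+1 <= tnth d (rshift m j) & pq.2 - pq.1 <= tnth d (rshift m j)].
    move=> j; have := Hs (rshift m j); rewrite /= ltnNge leq_addr /=.
    by case=> p [q H]; exists (p, q).
  exists (fun i => (r i).+1), (fun j => (pq j).1.+1), (fun j => (pq j).2.+1).
  split; last 1 first.
  + by move=> j; have [] := Hpq j; lia.
  + set w := _ ++ _.
    have sub : {subset iota 1 (m + 2 * n) <= w}.
      move=> x; rewrite mem_iota => /andP[x0 xN].
      have xN' : x.-1 < m + 2 * n by lia.
      have Ex : x = (Ordinal xN').+1 by rewrite /= prednK.
      rewrite Ex; move: (Ordinal xN') => y; rewrite /w !mem_cat.
      case: (split_ordP (s y)) => [i|j] sy.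
        have : y \in [set r i] by rewrite -(Hr i).1 inE sy.
        by rewrite inE => /eqP->; rewrite [X in _ || (X || _)]codom_f orbT.
      have [_ E _ _] := Hpq j.
      have : y \in [set (pq j).1; (pq j).2] by rewrite -E inE sy.
      rewrite !inE => /orP[]/eqP->.
        by rewrite [X in X || _]codom_f.
      by rewrite [X in _ || (_ || X)]codom_f !orbT.
    have sw : size w <= size (iota 1 (m + 2 * n)).
      by rewrite /w !size_cat !size_codom !card_ord size_iota; lia.
    apply: uniq_perm; [exact: leq_size_uniq (iota_uniq _ _) sub sw|exact: iota_uniq|move=> x].
    by have [_ ->] := uniq_min_size (iota_uniq _ _) sub sw.
  + by move=> i; case: (Hr i).
  + by move=> j; case: (Hpq j).
case=> r [p [q [E dS dD dQ]]].
(* A visit is a single visit or a pair of a task and a boolean, where [true] marks the second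
   visit. *)
pose pos (l : 'I_m + 'I_n * bool) : nat :=
  match l with inl i => r i | inr (j, false) => p j | inr (j, true) => q j end.
pose task (l : 'I_m + 'I_n * bool) :=
  match l with inl i => lshift n i | inr (j, _) => rshift m j end.
have /fin_all_exists[g pos_g] : forall x : 'I_(m + 2 * n), exists l, pos l = x.+1.
  move=> x; have : x.+1 \in iota 1 (m + 2 * n) by rewrite mem_iota /= ltnS ltn_ord.
  rewrite -(perm_mem E) !mem_cat => /or3P[]/codomP[i ->].
  - by exists (inr (i, false)).
  - by exists (inl i).
  - by exists (inr (i, true)).
have g_inj : injective g.
  by move=> x y gxy; apply/val_inj/eqP; rewrite -eqSS -!pos_g gxy.
have [|h gK hK] := inj_card_bij g_inj.
  by rewrite card_sum card_prod !card_ord card_bool; lia.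
have pos_h l : pos l = (h l).+1 by rewrite -pos_g hK.
have hE x l : (x == h l) = (g x == l) by rewrite -{1}(gK x) (can_eq hK).
exists [ffun x => task (g x)] => t.
case: (split_ordP t) => [i|j] ->; rewrite /= ?ltn_ord ?[_ < m]ltnNge ?leq_addr /=.
  exists (h (inl i)); split; last by rewrite -pos_h; apply: dS.
  apply/setP => x; rewrite !inE ffunE hE.
  case: (g x) => [i'|[j b]] /=; first by rewrite (inj_eq (@lshift_inj _ _)).
  by rewrite eq_rlshift.
have sj x : ([ffun x => task (g x)] x == rshift m j) =
    (x == h (inr (j, false))) || (x == h (inr (j, true))).
  rewrite ffunE !hE; case: (g x) => [i'|[j' b]] /=; first by rewrite eq_lrshift.
  rewrite (inj_eq (@rshift_inj _ _)).
  by rewrite -2![inr _ == _]/((_, _) == (_, _)) !xpair_eqE; case: b; rewrite ?andbT ?andbF ?orbF.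
have := dD j; have := dQ j.
rewrite (pos_h (inr (j, false)) : p j = _) (pos_h (inr (j, true)) : q j = _) => hq hp.
have pq : h (inr (j, false)) != h (inr (j, true)) by apply/eqP => /(can_inj hK) [].
have [lt_pq|lt_qp] := ltnP (h (inr (j, false))) (h (inr (j, true))).
  exists (h (inr (j, false))), (h (inr (j, true))); split=> //.
    by apply/setP => x; rewrite !inE sj.
  by rewrite leq_subLR -ltnS -addSn.
(* Here [q] comes first: it meets the deadline because the later [p] does, and the gap is at most
   the position of [p]. *)
exists (h (inr (j, true))), (h (inr (j, false))).
have {lt_qp}lt_qp : h (inr (j, true)) < h (inr (j, false)).
  by rewrite ltn_neqAle eq_sym pq.
split=> //.
- by apply/setP => x; rewrite !inE sj orbC.
- exact: ltn_trans lt_qp hp.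
- exact: leq_trans (leq_subr _ _) (ltnW hp).
Qed.

(** Positions never exceed [m + 2 * n], so larger deadlines can be cut; one pass over linearly many
    buckets then suffices. *)
Lemma schedule_minn m n (dS : 'I_m -> nat) (dD : 'I_n -> nat) r p q :
  schedule dS dD r p q <->
  schedule (fun i => minn (dS i) (m + 2 * n)) (fun j => minn (dD j) (m + 2 * n)) r p q.
Proof.
split=> [[E rS pD qD]|[E rS pD qD]]; last first.
  by split=> // i; [have := rS i|have := pD i|have := qD i]; lia.
have le_N x : x \in codom p ++ codom r ++ codom q -> x <= m + 2 * n.
  by rewrite (perm_mem E) mem_iota; lia.
split=> // i.
- have := rS i; have: r i <= m + 2 * n; last by lia.
  by apply: le_N; rewrite !mem_cat [X in _ || (X || _)]codom_f orbT.
- have := pD i; have: p i <= m + 2 * n; last by lia.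
  by apply: le_N; rewrite mem_cat [X in X || _]codom_f.
- have := qD i; have: q i <= m + 2 * n; last by lia.
  by apply: le_N; rewrite !mem_cat [X in _ || (_ || X)]codom_f !orbT.
Qed.

Lemma pending_start (I : Type) (d : I -> nat) s x :
  all (fun j => d j <= x) s -> pending d s x 0 (fun y => count_mem y (map d s)).
Proof.
move=> dx; split=> [|y _]; last by rewrite count_map.
apply/eqP; rewrite eqn0Ngt -has_count -all_predC; apply: sub_all dx => j /=.
by rewrite -leqNgt.
Qed.

(** * The greedy pass compared with schedules *)

Section Scanned.

Variables (m n : nat) (dS : 'I_m -> nat) (dD : 'I_n -> nat).
Variables (A R T : seq nat) (e : nat).
Hypothesis dS_bounds : forall i, 0 < dS i <= m + 2 * n.
Hypothesis dD_bounds : forall j, 0 < dD j <= m + 2 * n.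
Hypothesis scanned : scan (fun y => count_mem y (codom dS))
  (fun y => count_mem y (codom dD)) (m + 2 * n) 0 0 A R T e.

Let pendS : pending dS (enum 'I_m) (m + 2 * n) 0 (fun y => count_mem y (codom dS)).
Proof. by apply: pending_start; apply/allP => i _; case/andP: (dS_bounds i). Qed.

Let pendD : pending dD (enum 'I_n) (m + 2 * n) 0 (fun y => count_mem y (codom dD)).
Proof. by apply: pending_start; apply/allP => j _; case/andP: (dD_bounds j). Qed.

(** [A], [R] and [T] share out [m + 2 * n] positions, while [A] and [R] place all but [e] of the
    [m + n] tasks. *)
Lemma size_free : size T = n + e.
Proof.
have := perm_size (scan_perm scanned); rewrite !size_cat size_iota.
have HD : {in enum 'I_n, forall j, 0 < dD j} by move=> j _; case/andP: (dD_bounds j).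
have HS : {in enum 'I_m, forall j, 0 < dS j} by move=> j _; case/andP: (dS_bounds j).
by have := scan_size scanned pendD pendS HD HS; rewrite -!cardE !card_ord /=; lia.
Qed.

Lemma discretized_scan : e = 0 ->
  perm_eq (discretized (sort leq (codom dD))) (map Posz A).
Proof.
move=> e0; rewrite (@discretizedE (Posz (m + 2 * n))); last first.
  rewrite all_sort; apply/allP => _ /codomP[j ->].
  by rewrite lez_nat; case/andP: (dD_bounds j).
rewrite perm_rev (scan_latest scanned e0) //.
- have /permP E : perm_eq (rev (sort leq (codom dD))) (codom dD).
    by rewrite perm_rev perm_sort.
  by case: pendD => p0 _; split=> [|y _]; rewrite E // count_map.
- by rewrite rev_sorted sort_sorted //; apply: leq_total.
- by rewrite all_rev all_sort; apply/allP => _ /codomP[j ->]; case/andP: (dD_bounds j).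
Qed.

(** The exchange moves first visits only later and second visits only earlier, so
    [t j <= q j <= dD j + p j <= dD j + a j]. *)
Lemma schedule_scan r p q : schedule dS dD r p q ->
  e = 0 /\ exists a t : 'I_n -> nat,
    [/\ perm_eq (codom a) A, perm_eq (codom t) T, forall j, a j <= dD j &
        forall j, t j <= dD j + a j].
Proof.
case=> E rS pD qD.
pose pos (l : 'I_m + 'I_n * bool) : nat :=
  match l with inl i => r i | inr (j, false) => p j | inr (j, true) => q j end.
pose d (l : 'I_m + 'I_n * bool) : nat :=
  match l with inl i => dS i | inr (j, _) => dD j end.
pose js := [seq inr (j, false) : 'I_m + 'I_n * bool | j <- enum 'I_n].
pose ks := [seq inl i : 'I_m + 'I_n * bool | i <- enum 'I_m].
pose ls := [seq inr (j, true) : 'I_m + 'I_n * bool | j <- enum 'I_n].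
have pE : map pos (js ++ ks ++ ls) = codom p ++ codom r ++ codom q.
  by rewrite !map_cat /js /ks /ls -!(map_comp pos).
have [|||||e0 [pos' [A' T' j' l']]] := scan_exchange (d := d) (js := js) (ks := ks)
    (ls := ls) (pos := pos) scanned.
- by apply: (@map_uniq _ _ pos); rewrite pE (perm_uniq E) iota_uniq.
- by rewrite pE.
- by case: pendD => D0 Dy; split=> [|y ylt]; rewrite count_map; [exact: D0|exact: Dy].
- by case: pendS => D0 Dy; split=> [|y ylt]; rewrite count_map; [exact: D0|exact: Dy].
- by move=> l; rewrite mem_cat => /orP[]/mapP[i _ ->] /=.
split=> //; exists (fun j => pos' (inr (j, false))), (fun j => pos' (inr (j, true))).
split.
- by move: A'; rewrite -map_comp.
- by move: T'; rewrite -map_comp.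
- by move=> j; have /andP[] := j' _ (map_f _ (mem_enum 'I_n j)).
- move=> j; have /= := l' _ (map_f _ (mem_enum 'I_n j)).
  have /andP[/= h _] := j' _ (map_f _ (mem_enum 'I_n j)).
  by have := qD j; lia.
Qed.

(** The matching supplies first and second visits; the single visits take the positions [R]
    independently of it. *)
Lemma scan_schedule (a t : 'I_n -> nat) : e = 0 ->
  perm_eq (codom a) A -> perm_eq (codom t) T ->
  (forall j, a j <= dD j) -> (forall j, t j <= dD j + a j) ->
  exists r, schedule dS dD r a t.
Proof.
move=> e0 aA tT aD tD.
have [|r rR rS] := scan_assign scanned e0 pendS (enum_uniq _).
  by move=> i _; case/andP: (dS_bounds i).
exists r; split=> [|i||j]; rewrite 1?[a j + _]addnC //; last first.
  by apply: rS; rewrite mem_enum.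
by rewrite -(permPr (scan_perm scanned)) perm_cat // perm_cat.
Qed.

End Scanned.

(** * Matchings as pairs of functions on the tasks *)

(** Used to list the triples of a matching in the order of the tasks. *)
Lemma map_perm_lift (T1 T2 : eqType) (f : T1 -> T2) s t :
  perm_eq (map f s) t -> exists2 s', perm_eq s' s & map f s' = t.
Proof.
elim: t s => [|y t IH] s; first by move/perm_nilP; case: s => // _; exists [::].
move=> E; have /mapP[x xs yx] : y \in map f s by rewrite (perm_mem E) mem_head.
have [|s' ss' <-] := IH (rem x s).
  rewrite -(perm_cons y) -(permPr E) {1}yx -map_cons perm_map // perm_sym.
  exact: perm_to_rem.
exists (x :: s'); last by rewrite yx.
by rewrite perm_sym (permPl (perm_to_rem xs)) perm_cons perm_sym.
Qed.

Lemma matching_yesP (J : matching_instance) n (dD : 'I_n -> nat) (A : seq nat) :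
  pD J = codom dD :> seq nat ->
  perm_eq (discretized (sort leq (codom dD))) (map Posz A) ->
  matching_yes J <-> exists a t : 'I_n -> nat,
    [/\ perm_eq (codom a) A, perm_eq (codom t) (pT J), forall j, a j <= dD j &
        forall j, t j <= dD j + a j].
Proof.
move=> ED EA; split.
- case=> M []; rewrite ED => /map_perm_lift[M' M'M ED'].
  rewrite (permPr EA).
  move=> /(perm_trans (perm_map _ M'M)) PA /(perm_trans (perm_map _ M'M)) PT HM.
  have sM : size M' = n.
    by have := congr1 size ED'; rewrite size_map size_codom card_ord.
  pose x0 : nat * int * nat := (0, Posz 0, 0).
  have codomE (T' : eqType) (f : nat * int * nat -> T') :
      codom (fun j : 'I_n => f (nth x0 M' j)) = map f M'.
    apply: (@eq_from_nth _ (f x0)); rewrite ?size_codom ?card_ord ?size_map // => i lt_in.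
    rewrite (nth_map x0) ?sM // (nth_map (Ordinal lt_in)) ?size_enum_ord //.
    by rewrite nth_enum_ord.
  have M'P (j : 'I_n) : nth x0 M' j \in M by rewrite -(perm_mem M'M) mem_nth ?sM.
  (* These values come from [A], so they are natural numbers and taking absolute values loses
     nothing. *)
  have posA : {in M', forall x, Posz `|x.1.2|%N = x.1.2}.
    move=> x xM'; have: x.1.2 \in map Posz A.
      by rewrite -(perm_mem PA); apply: (map_f (fun z => z.1.2)).
    by case/mapP=> y _ ->.
  have dDE (j : 'I_n) : dD j = (nth x0 M' j).1.1.
    rewrite -(nth_map _ 0 (fun x => x.1.1)) ?sM // ED'.
    by rewrite (nth_map j) ?size_enum_ord // nth_ord_enum.
  exists (fun j => `|(nth x0 M' j).1.2|%N), (fun j => (nth x0 M' j).2).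
  have bounds (j : 'I_n) : `|(nth x0 M' j).1.2|%N <= dD j /\
      (nth x0 M' j).2 <= dD j + `|(nth x0 M' j).1.2|%N.
    have jM : nth x0 M' j \in M' by rewrite mem_nth ?sM.
    move: (M'P j) (posA _ jM) (dDE j).
    by case: (nth x0 M' j) => [[d a] t] /= /HM[] + + <-; lia.
  split; try by move=> j; case: (bounds j).
  - apply: (perm_map_inj (f := Posz)); first by move=> ? ? [].
    rewrite (codomE _ (fun x => `|x.1.2|%N)) -map_comp.
    by rewrite (_ : map _ M' = [seq x.1.2 | x <- M']) //; apply/eq_in_map => x /posA.
  - by rewrite (codomE _ snd).
- case=> a [t [aA tT aD tD]].
  exists [seq (dD j, Posz (a j), t j) | j <- enum 'I_n]; split.
  + by rewrite -map_comp ED.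
  + rewrite -map_comp ED (permPr EA).
    by have := perm_map Posz aA; rewrite /codom /image_mem -map_comp.
  + by rewrite -map_comp.
  + by move=> _ _ _ /mapP[j _ [-> -> ->]]; have := aD j; have := tD j; lia.
Qed.

(** * The machine *)

(* Registers 0, 1, 9 hold the constants 0, 1, 3 and register 4 holds N.  The two tables of
   bucket counts and the table receiving T are interleaved: entry y is at 20 + 3y,
   21 + 3y and 22 + 3y.  Registers 13 and 14 count the tasks pending in the pass,
   register 15 points to the next free entry of T, and register 17 is the shift.
   Jump targets are absolute: the loops start at 10 (single visits), 22 (double visits),
   36 (pass) and 58 (output of T). *)
Definition reduction : program :=
  [:: Const 1 1; Const 9 3; Const 10 20; Const 11 21; Const 12 22;
      Read 2; Read 3; Plus 4 2 3; Plus 4 4 3; Print 3;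
      Read 6; Minus 7 6 4; Minus 6 6 7; Plus 7 6 6; Plus 7 7 6; Plus 7 7 10;
      Get 8 7; Plus 8 8 1; Put 7 8; Minus 2 2 1; JumpPos 10 2;
      Plus 5 3 0;
      Read 6; Minus 7 6 4; Minus 6 6 7; Print 6; Plus 7 6 6; Plus 7 7 6;
      Plus 7 7 11; Get 8 7; Plus 8 8 1; Put 7 8; Minus 5 5 1; JumpPos 22 5;
      Plus 5 4 0; Plus 15 12 0;
      Plus 7 5 5; Plus 7 7 5; Plus 8 7 10; Get 8 8; Plus 13 13 8;
      Plus 8 7 11; Get 8 8; Plus 14 14 8; JumpPos 51 14; JumpPos 49 13;
      Put 15 5; Plus 15 15 9; JumpPos 52 1;
      Minus 13 13 1; JumpPos 52 1;
      Minus 14 14 1;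
      Minus 5 5 1; JumpPos 36 5;
      Plus 8 13 14; Minus 8 1 8; JumpPos 58 8; Plus 17 4 4;
      Get 6 12; Plus 6 6 17; Print 6; Plus 12 12 9; Minus 3 3 1; JumpPos 58 3].

(** * Running the machine within a time bound *)

(** At most [t] steps instead of exactly [t], so that branches of different lengths share one
    bound. *)
Definition reach (P : program) (t : nat) (s : config) (Q : config -> Prop) : Prop :=
  exists2 k, k <= t & Q (iter k (step P) s).

Lemma reach_done P t s (Q : config -> Prop) : Q s -> reach P t s Q.
Proof. by exists 0. Qed.

Lemma reach_trans P t u s (Q Q' : config -> Prop) :
  reach P t s Q -> (forall s', Q s' -> reach P u s' Q') -> reach P (t + u) s Q'.
Proof.
move=> [k kt Qk] /(_ _ Qk) [l lu Q'l]; exists (l + k); last by rewrite iterD.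
by rewrite addnC leq_add.
Qed.

Lemma reach_exec P t p r x y ins Q :
  onth P p = Some ins -> reach P t (exec ins (Config p r x y)) Q ->
  reach P t.+1 (Config p r x y) Q.
Proof.
by move=> Pp [k kt Qk]; exists k.+1; rewrite ?ltnS // iterSr /step Pp.
Qed.

(** The updated registers are replaced by a variable known only through its values, which keeps
    terms small over many instructions. *)
Lemma reach_update P t p r x y i v Q :
  (forall r' : nat -> nat, (forall j : nat, r' j = if j == i then v else r j) ->
    reach P t (Config p r' x y) Q) ->
  reach P t (Config p (update r i v) x y) Q.
Proof. by apply. Qed.

Arguments update : simpl never.

(** Table addresses are at least 20; the second form of hypothesis tells them apart from the working
    registers. *)
Ltac lookup :=
  repeat match goal with
  | H : forall j : nat, ?r j = (if _ then _ else _) |- context [?r _] => rewrite H /=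
  | H : forall i : nat, is_true (i < 20) -> (?a == i) = false
    |- context [?a == ?i] => rewrite (H i isT) /=
  | H : forall i : nat, is_true (i < 20) -> (?a == i) = false
    |- context [?i == ?a] => rewrite [i == a]eq_sym (H i isT) /=
  end.

Ltac exec1 := apply: reach_exec; [reflexivity | rewrite /=; lookup].

Ltac write1 H := exec1; apply: reach_update => ? H.

Definition array (b : nat) (r : nat -> nat) (c : nat -> nat) : Prop :=
  forall y, r (b + 3 * y) = c y.

Definition frame (ws : seq nat) (r r' : nat -> nat) : Prop :=
  forall i, i < 20 -> i \notin ws -> r' i = r i.

Lemma frame_trans ws r r' r'' : frame ws r r' -> frame ws r' r'' -> frame ws r r''.
Proof. by move=> f g i i20 iws; rewrite g // f. Qed.

Definition consts (N : nat) (r : nat -> nat) : Prop :=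
  [/\ r 0 = 0, r 1 = 1, r 4 = N & [/\ r 9 = 3, r 10 = 20, r 11 = 21 & r 12 = 22]].

Lemma frame_consts N ws r r' :
  frame ws r r' -> all (fun i => i \notin ws) [:: 0; 1; 4; 9; 10; 11; 12] ->
  consts N r -> consts N r'.
Proof.
move=> f /allP H [c0 c1 c4 [c9 c10 c11 c12]].
by do !split; rewrite f // H.
Qed.

(** * The loops of the program *)

Lemma count_once_body N d x y r :
  consts N r -> 0 < r 2 ->
  reach reduction 11 (Config 10 r (d :: x) y) (fun s => exists r',
    [/\ s = Config (if 0 < (r 2).-1 then 10 else 21) r' x y,
    frame [:: 2; 6; 7; 8] r r', r' 2 = (r 2).-1 &
    forall a, 20 <= a -> r' a = r a + (a == 20 + 3 * minn d N)]).
Proof.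
move=> [c0 c1 c4 [c9 c10 c11 c12]] r2.
write1 H1; write1 H2; write1 H3.
(* Two truncated subtractions compute the minimum. *)
rewrite c4 (_ : d - (d - N) = minn d N) in H3; last by lia.
write1 H4; write1 H5; write1 H6.
rewrite c10 (_ : _ + 20 = 20 + 3 * minn d N) in H6; last by lia.
move: (20 + 3 * _) (leq_addr (3 * minn d N) 20) H6 => b b20 H6.
have Hb (j : nat) : j < 20 -> (b == j) = false by move=> j20; apply/eqP; lia.
write1 H7; write1 H8; write1 H9; write1 H10; exec1; lookup.
rewrite c1 subn1.
apply: reach_done; eexists; split; first by [].
- move=> i i20; rewrite !inE !negb_or => /and4P[/negPf i2 /negPf i6 /negPf i7 /negPf i8].
  by lookup; rewrite [i == b]eq_sym Hb // !(i2, i6, i7, i8).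
- by lookup; rewrite c1 subn1.
- move=> a a20; have Ha (j : nat) : j < 20 -> (a == j) = false by move=> j20; apply/eqP; lia.
  by lookup; case: eqP => [->|]; rewrite ?addn0 ?c1.
Qed.

(** The conditional program counter lets the induction start at the empty list, for which the last
    jump has already left the loop. *)
Lemma count_once_loop N s : forall x y r cS cD,
  consts N r -> r 2 = size s -> array 20 r cS -> array 21 r cD ->
  reach reduction (11 * size s) (Config (if 0 < size s then 10 else 21) r (s ++ x) y)
    (fun st => exists r', [/\ st = Config 21 r' x y, frame [:: 2; 6; 7; 8] r r',
      array 20 r' (fun v => cS v + count_mem v (map (minn^~ N) s)) &
      array 21 r' cD]).
Proof.
elim: s => [|d s IH] x y r cS cD Cr r2 rS rD.
  apply: reach_done; exists r; split=> // v; by rewrite addn0.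
rewrite mulnS /=.
apply: reach_trans (count_once_body d (s ++ x) y Cr _) _; first by rewrite r2.
move=> _ [r' [-> fr' r'2 r'a]]; rewrite r2 /=.
have Cr' := frame_consts fr' isT Cr.
have rS' : array 20 r' (fun v => cS v + (minn d N == v)).
  move=> v; rewrite r'a ?leq_addr // rS; congr (_ + nat_of_bool _).
  by apply/eqP/eqP; lia.
have rD' : array 21 r' cD.
  move=> v; rewrite r'a; last by lia.
  by rewrite rD (_ : _ == _ = false) ?addn0 //; apply/eqP; lia.
have r'2' : r' 2 = size s by rewrite r'2 r2.
rewrite -[11 * size s]addn0; apply: reach_trans (IH x y r' _ _ Cr' r'2' rS' rD') _.
move=> _ [r'' [-> f'' S'' D'']]; apply: reach_done; exists r''; split=> //.
  exact: frame_trans fr' f''.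
by move=> v; rewrite S'' addnA.
Qed.

Lemma count_twice_body N d x y r :
  consts N r -> 0 < r 5 ->
  reach reduction 12 (Config 22 r (d :: x) y) (fun s => exists r',
    [/\ s = Config (if 0 < (r 5).-1 then 22 else 34) r' x (rcons y (minn d N)),
    frame [:: 5; 6; 7; 8] r r', r' 5 = (r 5).-1 &
    forall a, 20 <= a -> r' a = r a + (a == 21 + 3 * minn d N)]).
Proof.
move=> [c0 c1 c4 [c9 c10 c11 c12]] r5.
write1 H1; write1 H2; write1 H3.
rewrite c4 (_ : d - (d - N) = minn d N) in H3; last by lia.
exec1; write1 H4; write1 H5; write1 H6.
rewrite c11 (_ : _ + 21 = 21 + 3 * minn d N) in H6; last by lia.
have: 20 <= 21 + 3 * minn d N by lia.
move: (21 + 3 * _) H6 => b H6 b20.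
have Hb (j : nat) : j < 20 -> (b == j) = false by move=> j20; apply/eqP; lia.
write1 H7; write1 H8; write1 H9; write1 H10; exec1; lookup.
rewrite c1 subn1.
apply: reach_done; eexists; split; first by [].
- move=> i i20; rewrite !inE !negb_or => /and4P[/negPf i5 /negPf i6 /negPf i7 /negPf i8].
  by lookup; rewrite [i == b]eq_sym Hb // !(i5, i6, i7, i8).
- by lookup; rewrite c1 subn1.
- move=> a a20; have Ha (j : nat) : j < 20 -> (a == j) = false by move=> j20; apply/eqP; lia.
  by lookup; case: eqP => [->|]; rewrite ?addn0 ?c1.
Qed.

Lemma count_twice_loop N s : forall x y r cS cD,
  consts N r -> r 5 = size s -> array 20 r cS -> array 21 r cD ->
  reach reduction (12 * size s) (Config (if 0 < size s then 22 else 34) r (s ++ x) y)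
    (fun st => exists r', [/\ st = Config 34 r' x (y ++ map (minn^~ N) s),
      frame [:: 5; 6; 7; 8] r r', array 20 r' cS &
      array 21 r' (fun v => cD v + count_mem v (map (minn^~ N) s))]).
Proof.
elim: s => [|d s IH] x y r cS cD Cr r5 rS rD.
  by apply: reach_done; exists r; split=> [||//|v]; rewrite ?cats0 ?addn0.
rewrite mulnS /=.
apply: reach_trans (count_twice_body d (s ++ x) y Cr _) _; first by rewrite r5.
move=> _ [r' [-> fr' r'5 r'a]]; rewrite r5 /=.
have Cr' := frame_consts fr' isT Cr.
have rD' : array 21 r' (fun v => cD v + (minn d N == v)).
  move=> v; rewrite r'a; last by lia.
  by rewrite rD; congr (_ + nat_of_bool _); apply/eqP/eqP; lia.
have rS' : array 20 r' cS.
  move=> v; rewrite r'a; last by lia.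
  by rewrite rS (_ : _ == _ = false) ?addn0 //; apply/eqP; lia.
have r'5' : r' 5 = size s by rewrite r'5 r5.
rewrite -[12 * size s]addn0; apply: reach_trans (IH x _ r' _ _ Cr' r'5' rS' rD') _.
move=> _ [r'' [-> f'' S'' D'']]; apply: reach_done; exists r''; split=> //.
- by rewrite cat_rcons.
- exact: frame_trans fr' f''.
- by move=> v; rewrite D'' addnA.
Qed.

(** The longest path through the body, the one storing a free position, has 15 instructions. The
    three outcomes mirror [ScanTwice], [ScanOnce] and [ScanFree]. *)
Lemma scan_body N x (i o : seq nat) r :
  consts N r -> r 5 = x.+1 -> 20 <= r 15 ->
  let S := r 13 + r (20 + 3 * x.+1) in let D := r 14 + r (21 + 3 * x.+1) in
  reach reduction 15 (Config 36 r i o) (fun s => exists r',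
    [/\ s = Config (if 0 < x then 36 else 54) r' i o,
      frame [:: 5; 7; 8; 13; 14; 15] r r', r' 5 = x &
      [\/ [/\ 0 < D, r' 13 = S, r' 14 = D.-1, r' 15 = r 15 &
            forall a, 20 <= a -> r' a = r a],
          [/\ D = 0, 0 < S, r' 13 = S.-1, r' 14 = 0 &
            r' 15 = r 15 /\ forall a, 20 <= a -> r' a = r a] |
          [/\ D = 0, S = 0, r' 13 = 0 /\ r' 14 = 0, r' 15 = r 15 + 3 &
            forall a, 20 <= a -> r' a = if a == r 15 then x.+1 else r a]]]).
Proof.
move=> [c0 c1 c4 [c9 c10 c11 c12]] r5 r15 S D.
write1 H1; rewrite r5 in H1.
write1 H2; rewrite r5 in H2.
write1 H3; rewrite c10 (_ : _ + 20 = 20 + 3 * x.+1) in H3; last by lia.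
have ES : S = r 13 + r (20 + 3 * x.+1) by [].
have ED : D = r 14 + r (21 + 3 * x.+1) by [].
move: S D ES ED => S D ES ED.
have: 20 <= 20 + 3 * x.+1 by lia.
have: 20 <= 21 + 3 * x.+1 by lia.
have E21 : x.+1 + x.+1 + x.+1 + 21 = 21 + 3 * x.+1 by lia.
move: (20 + 3 * _) (21 + 3 * _) ES ED H3 E21 => a b ES ED H3 E21 b20 a20.
have Ha (j : nat) : j < 20 -> (a == j) = false by move=> j20; apply/eqP; lia.
have Hb (j : nat) : j < 20 -> (b == j) = false by move=> j20; apply/eqP; lia.
have Hc (j : nat) : j < 20 -> (r 15 == j) = false by move=> j20; apply/eqP; lia.
write1 H4; write1 H5; rewrite -ES in H5.
write1 H6; rewrite c11 E21 in H6.
write1 H7; write1 H8; rewrite -ED in H8.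
have low : forall j, j < 20 -> j \notin [:: 5; 7; 8; 13; 14; 15] ->
    [/\ (j == 5) = false, (j == 7) = false, (j == 8) = false, (j == 13) = false &
        (j == 14) = false /\ (j == 15) = false].
  by move=> j _; rewrite !inE !negb_or =>
    /and5P[/negPf-> /negPf-> /negPf-> /negPf-> /andP[/negPf-> /negPf->]].
exec1; case: (posnP D) => [D0|Dp].
  exec1; case: (posnP S) => [S0|Sp].
    write1 H9; rewrite r5 in H9.
    write1 H10; rewrite c9 in H10.
    exec1; rewrite c1 /=.
    write1 H11; rewrite r5 c1 subn1 in H11; exec1.
    apply: reach_done; eexists; split; first by [].
    - move=> j j20 /(low j j20) [j5 j7 j8 j13 [j14 j15]].
      by lookup; rewrite [j == r 15]eq_sym Hc // !(j5, j7, j8, j13, j14, j15).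
    - by lookup.
    - apply: Or33; split=> [//|//|||k k20]; [by lookup|by lookup|].
      have Hk (j : nat) : j < 20 -> (k == j) = false by move=> j20; apply/eqP; lia.
      by lookup.
  write1 H9; rewrite c1 subn1 in H9; exec1; rewrite c1 /=.
  write1 H11; rewrite r5 c1 subn1 in H11; exec1.
  apply: reach_done; eexists; split; first by [].
  - move=> j j20 /(low j j20) [j5 j7 j8 j13 [j14 j15]].
    by lookup; rewrite !(j5, j7, j8, j13, j14, j15).
  - by lookup.
  - apply: Or32; split=> [//|//|||]; [by lookup|by lookup|split=> [|k k20]; first by lookup].
    have Hk (j : nat) : j < 20 -> (k == j) = false by move=> j20; apply/eqP; lia.
    by lookup.
write1 H9; rewrite c1 subn1 in H9.
write1 H11; rewrite r5 c1 subn1 in H11; exec1.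
apply: reach_done; eexists; split; first by [].
- move=> j j20 /(low j j20) [j5 j7 j8 j13 [j14 j15]].
  by lookup; rewrite !(j5, j7, j8, j13, j14, j15).
- by lookup.
- apply: Or31; split=> [//||||k k20]; [by lookup|by lookup|by lookup|].
  have Hk (j : nat) : j < 20 -> (k == j) = false by move=> j20; apply/eqP; lia.
  by lookup.
Qed.

(** [k] counts the free positions stored so far. The last clause protects them, and so secures the
    entry written in the current round. *)
Lemma scan_loop N x : forall (i o : seq nat) r k cS cD,
  consts N r -> r 5 = x -> r 15 = 22 + 3 * k -> array 20 r cS -> array 21 r cD ->
  reach reduction (15 * x) (Config (if 0 < x then 36 else 54) r i o)
    (fun s => exists r' A R T,
      [/\ s = Config 54 r' i o, frame [:: 5; 7; 8; 13; 14; 15] r r',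
        scan cS cD x (r 13) (r 14) A R T (r' 13 + r' 14),
        forall j, j < size T -> r' (22 + 3 * (k + j)) = nth 0 T j &
        forall j, j < k -> r' (22 + 3 * j) = r (22 + 3 * j)]).
Proof.
elim: x => [|x IH] i o r k cS cD Cr r5 r15 rS rD.
  by apply: reach_done; exists r, [::], [::], [::]; split=> //; apply: Scan0.
rewrite mulnS /=; apply: reach_trans (scan_body i o Cr r5 _) _; first by rewrite r15.
move=> _ [r' [-> fr' r'5 +]]; rewrite rS rD => cases.
have Cr' := frame_consts fr' isT Cr.
have IH' k' : r' 15 = 22 + 3 * k' -> array 20 r' cS -> array 21 r' cD -> _ :=
  fun e s d => IH i o r' k' cS cD Cr' r'5 e s d.
case: cases => [[D0 r'13 r'14 r'15 r'a]|[D0 S0 r'13 r'14 [r'15 r'a]]|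
    [D0 S0 [r'13 r'14] r'15 r'a]].
- rewrite -[15 * x]addn0; apply: reach_trans (IH' k _ _ _) _; [by rewrite r'15
    |by move=> v; rewrite r'a ?leq_addr|by move=> v; rewrite r'a; [exact: rD|lia]|].
  move=> _ [r'' [A [R [T [-> f'' sc T'' l'']]]]]; apply: reach_done.
  exists r'', (x.+1 :: A), R, T; split=> //; first exact: frame_trans fr' f''.
    by apply: ScanTwice => //; move: sc; rewrite r'13 r'14.
  by move=> j jk; rewrite l'' // r'a //; lia.
- rewrite -[15 * x]addn0; apply: reach_trans (IH' k _ _ _) _; [by rewrite r'15
    |by move=> v; rewrite r'a ?leq_addr|by move=> v; rewrite r'a; [exact: rD|lia]|].
  move=> _ [r'' [A [R [T [-> f'' sc T'' l'']]]]]; apply: reach_done.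
  exists r'', A, (x.+1 :: R), T; split=> //; first exact: frame_trans fr' f''.
    by apply: ScanOnce => //; move: sc; rewrite r'13 r'14.
  by move=> j jk; rewrite l'' // r'a //; lia.
(* The entry written is at [22 + 3 * k]; the bucket tables occupy the other residues modulo 3. *)
- have r'S : array 20 r' cS.
    by move=> v; rewrite r'a ?leq_addr // ifN ?rS // r15; apply/eqP; lia.
  have r'D : array 21 r' cD.
    by move=> v; rewrite r'a ?ifN ?rD // ?r15; last lia; apply/eqP; lia.
  rewrite -[15 * x]addn0; apply: reach_trans (IH' k.+1 _ r'S r'D) _.
    by rewrite r'15 r15; lia.
  move=> _ [r'' [A [R [T [-> f'' sc T'' l'']]]]]; apply: reach_done.
  exists r'', A, R, (x.+1 :: T); split=> //; first exact: frame_trans fr' f''.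
  + by apply: ScanFree => //; move: sc; rewrite r'13 r'14.
  + case=> [_|j jT]; last by rewrite addnS -addSn T''.
    by rewrite addn0 l'' // r'a; [rewrite r15 eqxx|lia].
  + by move=> j jk; rewrite l'' ?r'a ?ifN // ?r15; try lia; apply/eqP; lia.
Qed.

Lemma print_loop l : forall (i o : seq nat) r a off,
  r 1 = 1 -> r 9 = 3 -> r 3 = size l -> r 12 = a -> r 17 = off -> 20 <= a ->
  (forall j, j < size l -> r (a + 3 * j) = nth 0 l j) ->
  reach reduction (6 * size l) (Config (if 0 < size l then 58 else 64) r i o)
    (fun s => exists r', s = Config 64 r' i (o ++ [seq t + off | t <- l])).
Proof.
elim: l => [|t l IH] i o r a off c1 c9 r3 r12 r17 a20 rl.
  by apply: reach_done; exists r; rewrite cats0.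
have Ha (j : nat) : j < 20 -> (a == j) = false by move=> j20; apply/eqP; lia.
have ra : r a = t by have := rl 0 isT; rewrite muln0 addn0.
rewrite mulnS /=.
write1 H1; rewrite r12 ra in H1; write1 H2; rewrite r17 in H2; exec1.
write1 H3; rewrite r12 c9 in H3; write1 H4; rewrite r3 c1 subn1 in H4; exec1.
have -> : o ++ t + off :: [seq t + off | t <- l] =
    rcons o (t + off) ++ [seq t + off | t <- l] by rewrite cat_rcons.
apply: (IH _ _ _ (a + 3)); try by lookup.
- lia.
- move=> j jl; have Hj (k : nat) : k < 20 -> (a + 3 + 3 * j == k) = false.
    by move=> k20; apply/eqP; lia.
  by lookup; have := rl j.+1 jl; rewrite /= => <-; congr r; lia.
Qed.

(** The last loop prints [n] entries even if tasks are unplaced, hence the premise on [size T]. *)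
Lemma reduction_reach m n (s t : seq nat) :
  0 < m -> 0 < n -> size s = m -> size t = n ->
  let N := m + 2 * n in
  let S := map (minn^~ N) s in let D := map (minn^~ N) t in
  let scanned := scan (fun v => count_mem v S) (fun v => count_mem v D) N 0 0 in
  (forall A R T e, scanned A R T e -> n <= size T) ->
  reach reduction (11 * m + 18 * n + 15 * N + 17) (start (m :: n :: s ++ t))
    (fun st => pc st = 64 /\ exists A R T e,
      scanned A R T e /\
      output st = n :: D ++ [seq x + (if e == 0 then 0 else N + N) | x <- take n T]).
Proof.
move=> m0 n0 sm tn N S D scanned leT.
(* Outside the loops there are ten instructions of setup, one before the second loop, two before the
   pass and four before the output. *)
rewrite (_ : 11 * m + 18 * n + 15 * N + 17 =
    (11 * m + (12 * n + (15 * N + (6 * n).+4).+2).+1).+4.+4.+2); last by lia.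
rewrite /start.
write1 H1; write1 H2; write1 H3; write1 H4; write1 H5; write1 H6; write1 H7.
write1 H8; write1 H9; exec1.
set r0 := (X in Config _ X).
have EN : m + n + n = N by rewrite /N; lia.
have Cr0 : consts N r0 by rewrite /r0 -EN; do !split; lookup.
have low0 (b : nat) : 20 <= b -> array b r0 (fun=> 0).
  move=> b20 v; have Hv (j : nat) : j < 20 -> (b + 3 * v == j) = false.
    by move=> j20; apply/eqP; lia.
  by rewrite /r0; lookup.
have loopS := count_once_loop (s := s) t [:: n] Cr0 _ (low0 20 isT) (low0 21 isT).
rewrite sm m0 in loopS; apply: reach_trans (loopS _) _; first by rewrite /r0; lookup.
have r03 : r0 3 = n by rewrite /r0; lookup.
have r013 : r0 13 = 0 by rewrite /r0; lookup.
have r014 : r0 14 = 0 by rewrite /r0; lookup.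
have r017 : r0 17 = 0 by rewrite /r0; lookup.
move: (r0) Cr0 r03 r013 r014 r017 {loopS low0 H1 H2 H3 H4 H5 H6 H7 H8 H9}.
move=> {}r0 Cr0 r03 r013 r014 r017 _ [r1 [-> f1 S1 D1]].
have Cr1 := frame_consts f1 isT Cr0.
have [c0 c1 c4 [c9 c10 c11 c12]] := Cr1.
write1 H1; rewrite c0 addn0 (f1 3) // r03 in H1.
set r2 := (X in Config _ X).
have f2 : frame [:: 5] r1 r2.
  by move=> j j20; rewrite inE /r2 H1 => /negPf->.
have Cr2 := frame_consts f2 isT Cr1.
have high2 (b : nat) c : 20 <= b -> array b r1 c -> array b r2 c.
  by move=> b20 bc v; rewrite /r2 H1 ifN ?bc //; apply/eqP; lia.
have loopD := count_twice_loop (s := t) [::] [:: n] Cr2 _ (high2 20 _ isT S1) (high2 21 _ isT D1).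
rewrite tn n0 cats0 in loopD; apply: reach_trans (loopD _) _; first by rewrite /r2 H1.
move=> _ [r3 [-> f3 S3 D3]].
have Cr3 := frame_consts f3 isT Cr2.
have r33 : r3 3 = n by rewrite f3 // f2 // f1.
have r313 : r3 13 = 0 by rewrite f3 // f2 // f1.
have r314 : r3 14 = 0 by rewrite f3 // f2 // f1.
have r317 : r3 17 = 0 by rewrite f3 // f2 // f1.
have {c0 c1 c4 c9 c10 c11 c12} [c0 c1 c4 [c9 c10 c11 c12]] := Cr3.
write1 H2; rewrite c4 c0 addn0 in H2; write1 H3; rewrite c12 c0 addn0 in H3.
set r4 := (X in Config _ X).
have f4 : frame [:: 5; 15] r3 r4.
  by move=> j j20; rewrite !inE negb_or /r4 H3 H2 => /andP[/negPf-> /negPf->].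
have Cr4 := frame_consts f4 isT Cr3.
have high4 (b : nat) c : 20 <= b -> array b r3 c -> array b r4 c.
  by move=> b20 bc v; rewrite /r4 H3 H2 !ifN ?bc //; apply/eqP; lia.
have N0 : 0 < N by rewrite /N; lia.
have loopN := scan_loop (k := 0) [::] (n :: D) Cr4 (_ : r4 5 = N) _
  (high4 20 _ isT S3) (high4 21 _ isT D3).
rewrite N0 in loopN; apply: reach_trans (loopN _ _) _; [by rewrite /r4 H3 H2|by rewrite /r4 H3|].
move=> _ [r5 [A [R [T [-> f5 sc T5 _]]]]].
rewrite !f4 // r313 r314 in sc.
have Cr5 := frame_consts f5 isT Cr4.
have {c0 c1 c4 c9 c10 c11 c12} [c0 c1 c4 [c9 c10 c11 c12]] := Cr5.
have r53 : r5 3 = n by rewrite f5 // f4.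
have r517 : r5 17 = 0 by rewrite f5 // f4.
have [e Ee] : exists e, e = r5 13 + r5 14 by eexists.
rewrite -Ee in sc.
have nT := leT _ _ _ _ sc.
have sT : size (take n T) = n by rewrite size_takel.
have nth_T j : j < n -> nth 0 (take n T) j = r5 (22 + 3 * j).
  by move=> jn; rewrite nth_take // -[j in RHS]add0n T5 // (leq_trans jn).
write1 H4; rewrite -Ee in H4; write1 H5; rewrite c1 in H5.
have finish r6 : frame [:: 8; 17] r5 r6 -> r6 17 = (if e == 0 then 0 else N + N) ->
    (forall j, 20 <= j -> r6 j = r5 j) ->
    reach reduction (6 * n) (Config 58 r6 [::] (n :: D)) (fun st =>
      pc st = 64 /\ exists A R T e, scanned A R T e /\
      output st = n :: D ++ [seq x + (if e == 0 then 0 else N + N) | x <- take n T]).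
  move=> f6 r617 h6.
  have loopP := print_loop (l := take n T) [::] (n :: D) _ _ _ _ r617 (isT : 20 <= 22) _.
  rewrite sT n0 in loopP; rewrite -[6 * n]addn0; apply: reach_trans (loopP _ _ _ _ _) _;
    try by rewrite f6.
  by move=> j jn; rewrite h6 ?nth_T //; lia.
  move=> _ [r7 ->]; apply: reach_done; split=> //.
  by exists A, R, T, e.
(* Register 8 holds [1 - e], positive exactly when all tasks are placed; the jump then skips the
   shift. *)
exec1; case: (posnP e) => [e0|ep].
  rewrite e0 subn0 /= -addn1.
  apply: reach_trans (finish _ _ _ _) _ => [j j20|||st Qst]; last exact: reach_done.
  - by rewrite !inE negb_or => /andP[/negPf j8 _]; rewrite H5 H4 j8.
  - by rewrite H5 H4 /= r517 e0.
  - by move=> j j20; rewrite H5 H4 !ifN //; apply/eqP; lia.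
rewrite (_ : 1 - e = 0) /=; last by lia.
write1 H6; rewrite c4 in H6; apply: finish => [j j20||].
- by rewrite !inE negb_or => /andP[/negPf j8 /negPf j17]; rewrite H6 H5 H4 j8 j17.
- by rewrite H6 /= ifN // -lt0n.
- by move=> j j20; rewrite H6 H5 H4 !ifN //; apply/eqP; lia.
Qed.

(** * Assembling the reduction *)

(** A halted configuration is a fixed point of [step], so a bound on the halting time can be raised
    to an exact later time. *)
Lemma reach_computes P t t' x (Q : config -> Prop) :
  reach P t (start x) Q -> (forall s, Q s -> halted P s) -> t <= t' ->
  Q (iter t' (step P) (start x)).
Proof.
move=> [k kt Qk] /(_ _ Qk) h tt'.
rewrite -(subnK (leq_trans kt tt')) iterD.
have step_id j : iter j (step P) (iter k (step P) (start x)) = iter k (step P) (start x).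
  by elim: j => //= j ->; rewrite /step onth_default.
by rewrite step_id.
Qed.

Lemma take_codom m n (d : (m + n).-tuple nat) :
  take m d = codom (fun i => tnth d (lshift n i)).
Proof.
have sm : size (take m d) = m by rewrite size_takel // size_tuple leq_addr.
apply: (@eq_from_nth _ 0) => [|i]; rewrite sm ?size_codom ?card_ord // => im.
rewrite (nth_map (Ordinal im)) ?size_enum_ord // (tnth_nth 0) /= nth_enum_ord //.
by rewrite nth_take.
Qed.

Lemma drop_codom m n (d : (m + n).-tuple nat) :
  drop m d = codom (fun j => tnth d (rshift m j)).
Proof.
have sn : size (drop m d) = n by rewrite size_drop size_tuple addKn.
apply: (@eq_from_nth _ 0) => [|i]; rewrite sn ?size_codom ?card_ord // => lt_in.
rewrite (nth_map (Ordinal lt_in)) ?size_enum_ord // (tnth_nth 0) /= nth_enum_ord //.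
by rewrite nth_drop.
Qed.

Theorem theorem14 :
  reduces_in_time (A := one_or_two_visits) position_matching
    (fun I : visits_instance => vn I + vm I).
Proof.
(* The time bound amounts to [26 * m + 48 * n + 17], and 65 is [48 + 17], as [m + n] is positive. *)
exists reduction, 65 => I /=.
have := visits_yesP I; move: (visits_yes I); rewrite /visits_encode.
case: I => m n d /= m0 n0 d0 _ _ visits visitsE.
set N := m + 2 * n.
pose dS (i : 'I_m) := minn (tnth d (lshift n i)) N.
pose dD (j : 'I_n) := minn (tnth d (rshift m j)) N.
have N0 : 0 < N by rewrite /N; lia.
have d_gt0 i : 0 < tnth d i by apply: (allP d0); apply: mem_tnth.
have dS_bounds i : 0 < dS i <= N by rewrite geq_minr leq_min d_gt0 N0.
have dD_bounds j : 0 < dD j <= N by rewrite geq_minr leq_min d_gt0 N0.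
have ES : map (minn^~ N) (take m d) = codom dS by rewrite take_codom -map_comp.
have ED : map (minn^~ N) (drop m d) = codom dD by rewrite drop_codom -map_comp.
have sizeT A R T e := @size_free m n dS dD A R T e dS_bounds dD_bounds.
have sm : size (take m d) = m by rewrite size_takel // size_tuple leq_addr.
have sn : size (drop m d) = n by rewrite size_drop size_tuple addKn.
have leT A R T e : scan (fun v => count_mem v (codom dS))
    (fun v => count_mem v (codom dD)) N 0 0 A R T e -> n <= size T.
  by move=> /sizeT ->; apply: leq_addr.
have := @reduction_reach m n (take m d) (drop m d) m0 n0.
cbv zeta; rewrite -/N ES ED cat_take_drop => /(_ sm sn leT) R.
have [||pcE [A [R' [T [e [sc out]]]]]] := reach_computes (t' := 65 * (n + m)) R.
- by move=> s [pcE _]; rewrite /halted pcE.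
- by rewrite /N; lia.
have sT : size T = n + e := sizeT _ _ _ _ sc.
set off := if e == 0 then 0 else N + N.
have sizeD : size (codom dD) == n by rewrite size_codom card_ord.
have sizePT : size [seq x + off | x <- take n T] == n.
  by rewrite size_map size_takel // sT leq_addr.
have T_pos : all (leq 1) T.
  apply/allP => x xT; have: x \in iota 1 N.
    by rewrite -(perm_mem (scan_perm sc)) !mem_cat xT !orbT.
  by rewrite mem_iota => /andP[].
have T_uniq : uniq T.
  have: uniq (A ++ R' ++ T) by rewrite (perm_uniq (scan_perm sc)) iota_uniq.
  by rewrite !cat_uniq => /and3P[_ _ /and3P[]].
have D_gt0 : all (leq 1) (Tuple sizeD).
  by apply/allP => _ /codomP[j ->]; case/andP: (dD_bounds j).
have PT_gt0 : all (leq 1) (Tuple sizePT).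
  apply/allP => _ /mapP[x /mem_take xT ->]; have := allP T_pos x xT; lia.
have PT_uniq : uniq (Tuple sizePT).
  by rewrite map_inj_uniq ?take_uniq //; apply: addIn.
exists (MatchingInstance n0 D_gt0 PT_gt0 PT_uniq); split.
  by split; [rewrite /halted pcE|rewrite out].
have disc := discretized_scan dD_bounds sc.
rewrite visitsE; split.
- case=> r [p [q /schedule_minn sched]].
  have [e0 [a [t [aA tT aD tD]]]] := schedule_scan dS_bounds dD_bounds sc sched.
  apply/(matching_yesP _ (disc e0)) => //=; exists a, t; split=> //.
  (* With [e = 0] the list [T] has exactly [n] elements and the shift is 0, so [T] itself is
     printed. *)
  rewrite /off e0 eqxx take_oversize ?sT ?e0 ?addn0 //.
  by rewrite (eq_map (g := id)) ?map_id // => x; rewrite addn0.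
- have [e0|e_gt0] := posnP e.
    move=> /(matching_yesP _ (disc e0)) /= /(_ erefl).
    case=> a [t [aA tT aD tD]].
    have [|r sched] := scan_schedule dS_bounds sc e0 aA _ aD tD.
      move: tT; rewrite /off e0 take_oversize ?sT ?e0 ?addn0 //.
      by rewrite (eq_map (g := id)) ?map_id // => x; rewrite addn0.
    by exists r, a, t; apply/schedule_minn.
  (* Tasks are unplaced here. Since [n] is positive some triple exists, but [a <= d <= N] gives
     [d + a <= N + N], below every shifted position. *)
  case=> M [PD _ PT HM]; exfalso.
  case: M PD PT HM => [|[[v a] u] M] PD PT HM.
    by have := perm_size PD; rewrite /= size_codom card_ord; lia.
  have [] := HM v a u (mem_head _ _).
  have : v \in codom dD by rewrite -(perm_mem PD) mem_head.
  case/codomP=> j ->; have := dD_bounds j.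
  have : u \in [seq x + off | x <- take n T] by rewrite -(perm_mem PT) mem_head.
  case/mapP=> x /mem_take /(allP T_pos) /= x0 ->; rewrite /off.
  by case: eqP => [|_]; lia.
Qed.
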